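(* Let $n \ge 2$ be an integer and let $d$ be a real number. If $\mathcal{A}$ and $\mathcal{B}$ are families of subsets of $[n] = \{1,\dots,n\}$ with $|\mathcal{A}|\,|\mathcal{B}| = n^d 2^n$, then \[ c(\mathcal{A},\mathcal{B}) \le 2^{-d/300}\, |\mathcal{A}|\,|\mathcal{B}|. \]
   Context: For two set families $\mathcal{A},\mathcal{B}$, $c(\mathcal{A},\mathcal{B})$ denotes the number of ordered pairs $(A,B) \in \mathcal{A}\times\mathcal{B}$ with $A \subseteq B$. *)

(* Defs.v *)
From mathcomp Require Import all_boot.
Set Implicit Arguments.
Unset Strict Implicit.
Unset Printing Implicit Defensive.

Definition containments (T : finType) (A B : {set {set T}}) : nat :=
  #|[set p in setX A B | p.1 \subset p.2]|.

(* Main.v *)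
(* Put P = |A||B| / 2^n, p = c(A,B) / (|A||B|) and eps = ln 2 / (300 ln n), so
   that the claim reads p <= P^(-eps).

   A two-point inequality, which holds up to a factor 1 + n^(-7), tensorises by
   induction on the ground set to p <= (1 + n^(-7))^n P^(-2 eps). If p > P^(-eps),
   this gives 1 < (1 + n^(-7))^n p, which is impossible unless the proportion
   eta = 1 - p of non-containments is below n^(-6).

   In that case let U be the union of the members of A that lie in almost all
   members of B. Almost all of A lies below U and almost all of B above U, and
   since P >= 1 these parts nearly fill 2^U and {Y | U \subset Y}; hence every
   other set fails to be comparable to a constant fraction of the opposite family.
   So these exceptional sets are at most a proportion 12 eta of A and of B, and
   P (1 - 12 eta)^2 <= 1, which is more than enough. *)
Require Import Defs.
From mathcomp Require Import all_boot all_order all_algebra.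
From mathcomp Require Import zify ring lra.
From mathcomp Require Import reals sequences exp.
Set Implicit Arguments.
Unset Strict Implicit.
Unset Printing Implicit Defensive.
Import Order.TTheory GRing.Theory Num.Theory.
Local Open Scope ring_scope.

(** * Containment counts and splitting at a point *)

Section Counting.
Local Open Scope nat_scope.
Variable T : finType.
Implicit Types (A B : {set {set T}}) (U V X Y : {set T}).

Lemma containmentsE A B :
  containments A B = \sum_(X in A) \sum_(Y in B) (X \subset Y : nat).
Proof.
rewrite pair_big_dep /= /containments -sum1_card big_mkcond /=.
rewrite [RHS]big_mkcond /=; apply: eq_bigr => -[X Y] _ /=.
by rewrite !inE /=; case: (X \in A); case: (Y \in B); case: (X \subset Y).
Qed.

Lemma containments_le A B : containments A B <= #|A| * #|B|.
Proof.
rewrite -cardsX; apply: subset_leq_card; apply/subsetP => p.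
by rewrite inE => /andP[].
Qed.

(** Together with [avoid], this encodes a family as two families on the ground set without [x], the
    form that the induction on points needs. *)
Definition del x A := [set X :\ x | X : {set T} in A & x \in X].
Definition avoid x A := [set X in A | x \notin X].

Lemma setD1_inj x X Y : x \in X -> x \in Y -> X :\ x = Y :\ x -> X = Y.
Proof.
move=> xX xY E.
by rewrite -(setD1K xX) -(setD1K xY) E.
Qed.

Lemma card_split x A : #|A| = #|avoid x A| + #|del x A|.
Proof.
rewrite card_in_imset; last first.
  by move=> X Y; rewrite !inE => /andP[_ xX] /andP[_ xY]; apply: setD1_inj.
rewrite -(cardsID [set X : {set T} | x \notin X] A); congr (_ + _); apply: eq_card => X.
  by rewrite !inE.
by rewrite !inE negbK andbC.
Qed.

(** Of the four ways to place [x], only [x] in [X] but not in [Y] excludes containment; in the other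
    three, deleting [x] changes nothing. Hence three terms. *)
Lemma containments_split x A B :
  containments A B = containments (avoid x A) (avoid x B)
    + containments (avoid x A) (del x B) + containments (del x A) (del x B).
Proof.
have split (F : {set T} -> nat) (C : {set {set T}}) :
    \sum_(X in C) F X = \sum_(X in avoid x C) F X + \sum_(X in del x C) F (x |: X).
  rewrite big_imset /=; last first.
    by move=> X Y; rewrite !inE => /andP[_ xX] /andP[_ xY]; apply: setD1_inj.
  rewrite (bigID [pred X : {set T} | x \notin X]) /=; congr (_ + _).
    by apply: eq_bigl => X; rewrite !inE.
  apply: eq_big => X; first by rewrite !inE negbK.
  by case/andP=> _; rewrite negbK => xX; rewrite setD1K.
rewrite !containmentsE split; congr (_ + _).
  rewrite -big_split; apply: eq_bigr => X; rewrite inE => /andP[_ xX] /=.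
  rewrite split; congr (_ + _); apply: eq_bigr => Y _; congr nat_of_bool.
  apply/idP/idP=> [/subsetP XY|/subset_trans-> //]; last exact: subsetU1.
  apply/subsetP=> z zX; have := XY _ zX; rewrite !inE.
  by case: eqP => // zx; rewrite zx (negbTE xX) in zX.
apply: eq_bigr => X /imsetP[X0]; rewrite !inE => /andP[_ xX0] ->.
rewrite split big1 ?add0n => [|Y]; last first.
  rewrite inE => /andP[_ xY]; case: subsetP => // /(_ x).
  by rewrite !inE eqxx (negbTE xY) => /(_ isT).
apply: eq_bigr => Y /imsetP[Y0]; rewrite !inE => /andP[_ xY0] ->.
by congr nat_of_bool; rewrite !setD1K // subDset setD1K.
Qed.

(** * Families with few non-containments *)

Lemma card_supersets U : #|[set Y : {set T} | U \subset Y]| = 2 ^ (#|T| - #|U|).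
Proof.
have -> : #|T| - #|U| = #|~: U| by rewrite [RHS]cardsCs setCK.
rewrite -card_powerset -(card_imset _ (@setC_inj T)).
apply: eq_card => Y; rewrite powersetE -[in RHS](setCK Y) setCS.
by rewrite -[in LHS](setCK Y) mem_imset ?inE //; apply: setC_inj.
Qed.

Definition deficit B X := #|[set Y in B | ~~ (X \subset Y)]|.

Lemma sum_deficit A B :
  containments A B + \sum_(X in A) deficit B X = #|A| * #|B|.
Proof.
rewrite containmentsE -big_split -sum_nat_const; apply: eq_bigr => X _ /=.
rewrite /deficit -(cardsID [set Y : {set T} | X \subset Y] B); congr (_ + _).
  rewrite -sum1_card [RHS]big_mkcond [LHS]big_mkcond; apply: eq_bigr => Y _.
  by rewrite !inE; case: (Y \in B); case: (X \subset Y).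
by apply: eq_card => Y; rewrite !inE andbC.
Qed.

Definition compl A : {set {set T}} := [set ~: X | X in A].

Lemma card_compl A : #|compl A| = #|A|.
Proof. by rewrite card_imset //; apply: setC_inj. Qed.

(** Complementation reverses inclusion and so swaps the two families; this lets [deficit_above]
    bound the exceptional members of [B] too. *)
Lemma containments_compl A B :
  containments (compl B) (compl A) = containments A B.
Proof.
have inj C : {in C &, injective (@setC T)} by move=> ? ? _ _; apply: setC_inj.
rewrite !containmentsE big_imset // [RHS]exchange_big; apply: eq_bigr => Y _.
by rewrite big_imset //; apply: eq_bigr => X _; rewrite setCS.
Qed.

Definition below U A := [set X in A | X \subset U].
Definition above U A := [set X in A | U \subset X].

Lemma card_above_compl U A : #|above (~: U) (compl A)| = #|below U A|.
Proof.
rewrite -[RHS]card_compl; apply: eq_card => X; rewrite -(setCK X).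
by rewrite !inE !mem_imset ?inE ?setCS //; apply: setC_inj.
Qed.

Lemma card_below_compl U A : #|below (~: U) (compl A)| = #|above U A|.
Proof.
rewrite -[RHS]card_compl; apply: eq_card => X; rewrite -(setCK X).
by rewrite !inE !mem_imset ?inE ?setCS //; apply: setC_inj.
Qed.

Lemma card_below_le U A : #|below U A| <= 2 ^ #|U|.
Proof.
rewrite -card_powerset; apply/subset_leq_card/subsetP => X.
by rewrite !inE => /andP[].
Qed.

Lemma card_above_le U A : #|above U A| <= 2 ^ (#|T| - #|U|).
Proof.
rewrite -card_supersets; apply/subset_leq_card/subsetP => X.
by rewrite !inE => /andP[].
Qed.

(* A set containing a point outside [U] is contained in at most half of the
   supersets of [U]. *)
Lemma deficit_above U A B :
  9 * 2 ^ (#|T| - #|U|) <= 16 * #|above U B| -> 3 * #|B| <= 4 * #|above U B| ->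
  (#|A| - #|below U A|) * #|B| <= 12 * (#|A| * #|B| - containments A B).
Proof.
move=> many large; rewrite -(sum_deficit A B) addKn.
have -> : #|A| - #|below U A| = #|A :\: below U A|.
  rewrite -(cardsID (below U A) A) (setIidPr _) ?addKn //.
  by apply/subsetP => X; rewrite inE => /andP[].
rewrite -sum_nat_const big_distrr /=.
apply: (@leq_trans (\sum_(X in A :\: below U A) 12 * deficit B X)); last first.
  rewrite big_mkcond [leqRHS]big_mkcond; apply: leq_sum => X _.
  by rewrite inE; case: (X \in A); case: (X \in below U A).
apply: leq_sum => X; rewrite !inE => /andP[+ XA]; rewrite XA /=.
case/subsetPn => x xX xU.
have E : #|x |: U| = #|U|.+1 by rewrite cardsU1 xU.
have := max_card (mem (x |: U)); rewrite E => UT.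
have : #|above U B| <= deficit B X + 2 ^ (#|T| - #|x |: U|).
  rewrite -card_supersets -(cardsID [set Y : {set T} | ~~ (X \subset Y)] (above U B)).
  apply: leq_add; apply/subset_leq_card/subsetP => Y; rewrite !inE.
    by case/andP=> /andP[-> _] ->.
  rewrite negbK => /and3P[XY _ UY]; rewrite subUset UY sub1set.
  by rewrite (subsetP XY).
(* The subtracted power is at most 8/9 of [#|above U B|], so the deficit is at least 1/9 of it,
   hence at least 1/12 of [#|B|]. *)
move: many; rewrite E (_ : #|T| - #|U| = (#|T| - #|U|.+1).+1); last by lia.
rewrite expnS; move: large; clear; move: (2 ^ _) (deficit _ _) #|above _ _| #|B|.
lia.
Qed.

Lemma almost_product A B :
  0 < #|T| ->
  16 * #|T| * (#|A| * #|B| - containments A B) <= #|A| * #|B| ->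
  2 ^ #|T| <= #|A| * #|B| ->
  exists a b : nat, [/\ a * b <= 2 ^ #|T|,
    (#|A| - a) * #|B| <= 12 * (#|A| * #|B| - containments A B),
    (#|B| - b) * #|A| <= 12 * (#|A| * #|B| - containments A B),
    a <= #|A| & b <= #|B|].
Proof.
move=> T0 few AB; set N := _ - _ in few *.
(* The threshold serves twice: averaging puts at least 3/4 of [A] into [A1], and a union bound over
   the points of [U] loses at most 1/4 of [B]. *)
pose A1 := [set X in A | 4 * #|T| * deficit B X <= #|B|].
pose U := \bigcup_(X in A1) X.
exists #|below U A|, #|above U B|.
have ab : #|below U A| * #|above U B| <= 2 ^ #|T|.
  apply: leq_trans (leq_mul (card_below_le U A) (card_above_le U B)) _.
  by rewrite -expnD subnKC // max_card.
have pos : 0 < #|A| * #|B| by apply: leq_trans AB; rewrite expn_gt0.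
have le_a : #|below U A| <= #|A|.
  by apply/subset_leq_card/subsetP => X; rewrite inE => /andP[].
have le_b : #|above U B| <= #|B|.
  by apply/subset_leq_card/subsetP => X; rewrite inE => /andP[].
have NE : \sum_(X in A) deficit B X = N by rewrite /N -(sum_deficit A B) addKn.
have large_a : 3 * #|A| <= 4 * #|below U A|.
  have : (#|A| - #|A1|) * #|B| <= 4 * #|T| * N.
    have -> : #|A| - #|A1| = #|A :\: A1|.
      rewrite -(cardsID A1 A) (setIidPr _) ?addKn //.
      by apply/subsetP => X; rewrite inE => /andP[].
    rewrite -NE -sum_nat_const big_distrr /= big_mkcond [leqRHS]big_mkcond.
    apply: leq_sum => X _; rewrite !inE; case: (X \in A) => //=.
    by rewrite andbT -ltnNge; case: ltnP => // /ltnW.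
  have : #|A1| <= #|below U A|.
    apply/subset_leq_card/subsetP => X XA1; rewrite inE (bigcup_sup X) // andbT.
    by move: XA1; rewrite inE => /andP[].
  nia.
have large_b : 3 * #|B| <= 4 * #|above U B|.
  have : 4 * (#|B| - #|above U B|) <= #|B|.
    have -> : #|B| - #|above U B| = #|B :\: above U B|.
      rewrite -(cardsID (above U B) B) (setIidPr _) ?addKn //.
      by apply/subsetP => X; rewrite inE => /andP[].
    have cover : #|B :\: above U B| <= \sum_(x in U) #|[set Y in B | x \notin Y]|.
      rewrite -sum1_card; under [leqRHS]eq_bigr do rewrite -sum1_card big_mkcond.
      rewrite exchange_big big_mkcond /=; apply: leq_sum => Y _; rewrite !inE.
      case: (boolP (Y \in B)) => //= YB; rewrite andbT; case: subsetPn => // -[x xU xY].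
      by rewrite (bigD1 x) //= inE YB xY.
    rewrite -(leq_pmul2l T0) mulnCA mulnA.
    apply: leq_trans (leq_mul (leqnn _) cover) _.
    rewrite big_distrr /= (@leq_trans (\sum_(x in U) #|B|)) //; last first.
      by rewrite sum_nat_const leq_mul2r max_card orbT.
    apply: leq_sum => x /bigcupP[X]; rewrite inE => /andP[_ small] xX.
    apply: leq_trans small; rewrite leq_mul2l; apply/orP; right.
    apply/subset_leq_card/subsetP => Y; rewrite !inE => /andP[-> xY] /=.
    by apply/subsetPn; exists x.
  lia.
have prod9 : 9 * (#|A| * #|B|) <= 16 * (#|below U A| * #|above U B|) by nia.
have := card_below_le U A; have := card_above_le U B => b_le a_le.
have pq : 2 ^ #|U| * 2 ^ (#|T| - #|U|) = 2 ^ #|T|.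
  by rewrite -expnD subnKC // max_card.
have p0 : 0 < 2 ^ #|U| by rewrite expn_gt0.
have q0 : 0 < 2 ^ (#|T| - #|U|) by rewrite expn_gt0.
(* The two parts lie in cubes whose sizes multiply to [2 ^ #|T|], so by [prod9] each fills at least
   9/16 of its cube, as [deficit_above] requires. *)
split=> //.
  apply: (deficit_above (U := U)) => //.
  rewrite -(leq_pmul2l p0); nia.
have := @deficit_above (~: U) (compl B) (compl A).
rewrite containments_compl !card_compl card_above_compl card_below_compl.
rewrite (mulnC #|B|) -/N; apply=> //.
have -> : #|T| - #|~: U| = #|U| by rewrite [RHS]cardsCs.
rewrite -(leq_pmul2l q0); nia.
Qed.

End Counting.

(** * The two-point power inequality *)

Section OneDim.
Variable R : realType.
Implicit Types (e s t x y r M a b : R).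

(** Weighted AM-GM of [t] and 1: with [w] the weighted mean, add [ln z <= z - 1] at [t / w] and
    [1 / w] with weights [s] and [1 - s]. *)
Lemma powR_le_tangent s t : 0 <= s <= 1 -> 0 <= t -> t `^ s <= 1 + s * (t - 1).
Proof.
move=> /andP[s0 s1]; rewrite le_eqVlt => /predU1P[<-|t0].
  have [->|sN0] := eqVneq s 0; first by rewrite powRr0 mul0r addr0.
  by rewrite powR0 //; lra.
set w := 1 + _; have w0 : 0 < w.
  rewrite /w; have [s_gt|] := ltP 0 s; last by nra.
  by have := mulr_gt0 s_gt t0; nra.
have le_ln_sub1 (z : R) : 0 < z -> ln z <= z - 1.
  by move=> z0; rewrite -{1}(subrK 1 z) addrC le_ln1Dx //; lra.
rewrite -ler_ln ?posrE ?powR_gt0 // ln_powR.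
have wV : 0 < w^-1 by rewrite invr_gt0.
have := le_ln_sub1 _ (mulr_gt0 t0 wV); have := le_ln_sub1 _ wV.
rewrite lnM ?posrE // lnV ?posrE // => h1 h2.
have : s * (t / w) + (1 - s) * w^-1 = 1 by rewrite /w; field; apply: lt0r_neq0.
nra.
Qed.

(** The tangent bound at [1 / (r * M)] with exponent [2 * e]. The result is linear in [r] and
    [r ^+ 2], so it can be summed over the two points. *)
Lemma powR_sqr_le e M r : 0 <= e <= 2^-1 -> 0 < M -> 0 <= r ->
  (r ^+ 2) `^ (1 - e) <= M `^ (2 * e) * (r ^+ 2 + 2 * e * (r / M - r ^+ 2)).
Proof.
move=> /andP[e0 e1] M0; rewrite le_eqVlt => /predU1P[<-|r0].
  by rewrite expr0n /= powR0 ?mul0r ?subr0 ?mulr0 ?addr0 ?mulr0 //; lra.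
have rM : 0 < r * M by rewrite mulr_gt0.
have -> : (r ^+ 2) `^ (1 - e) = M `^ (2 * e) * (r ^+ 2 * (r * M)^-1 `^ (2 * e)).
  have -> : (r * M)^-1 `^ (2 * e) = (r `^ (2 * e) * M `^ (2 * e))^-1.
    by rewrite -powR_inv1 ?ltW // -powRrM mulN1r powRN powRM ?ltW.
  rewrite powRB; last by rewrite expf_neq0 ?implybT // lt0r_neq0.
  rewrite powRr1 ?sqr_ge0 //.
  have -> : (r ^+ 2) `^ e = r `^ (2 * e) by rewrite -powR_mulrn ?ltW // -powRrM.
  by field; rewrite !gt_eqF ?powR_gt0.
rewrite ler_wpM2l ?powR_ge0 //.
have -> : r ^+ 2 + 2 * e * (r / M - r ^+ 2)
   = r ^+ 2 * (1 + 2 * e * ((r * M)^-1 - 1)).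
  by field; rewrite !gt_eqF.
rewrite ler_wpM2l ?sqr_ge0 // powR_le_tangent ?invr_ge0 ?(ltW rM) //; lra.
Qed.

Definition powsum e x := x `^ (1 - e) + (1 - x) `^ (1 - e).

Lemma powsum_ge0 e x : 0 <= powsum e x.
Proof. by rewrite addr_ge0 ?powR_ge0. Qed.

(* The entropy-type sum [E (1/p)^e] is compared with [(E (1/p)^(1/2))^(2e)]. *)
Lemma powsum_le e M r : 0 <= e <= 2^-1 -> 0 < M -> 0 <= r <= 1 ->
  r + Num.sqrt (1 - r ^+ 2) <= M -> powsum e (r ^+ 2) <= M `^ (2 * e).
Proof.
move=> e01 M0 /andP[r0 r1] rM.
have r21 : 0 <= 1 - r ^+ 2 by nra.
have h1 := powR_sqr_le e01 M0 r0.
have := powR_sqr_le e01 M0 (sqrtr_ge0 (1 - r ^+ 2)).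
rewrite sqr_sqrtr // => h2.
apply: le_trans (lerD h1 h2) _; rewrite -mulrDr ler_piMr ?powR_ge0 //.
set q := Num.sqrt _ in rM *.
have : (r + q) / M <= 1 by rewrite ler_pdivrMr ?mul1r.
rewrite mulrDl; case/andP: e01; nra.
Qed.

Lemma powsum_le2 e x : 0 <= e <= 2^-1 -> 0 <= x <= 1 -> powsum e x <= 2 `^ e.
Proof.
move=> e01 /andP[x0 x1]; rewrite -(sqr_sqrtr x0).
have s20 : (0 : R) < Num.sqrt 2 by rewrite sqrtr_gt0.
have -> : (2 : R) `^ e = Num.sqrt 2 `^ (2 * e).
  by rewrite powRrM powR_mulrn ?sqrtr_ge0 // sqr_sqrtr.
apply: powsum_le => //; first by rewrite sqrtr_ge0 -sqrtr1 ler_wsqrtr.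
rewrite sqr_sqrtr // -(@ler_pXn2r _ 2) ?nnegrE ?addr_ge0 ?sqrtr_ge0 //.
rewrite sqr_sqrtr // sqrrD !sqr_sqrtr ?subr_ge0 //.
have := sqr_ge0 (Num.sqrt x - Num.sqrt (1 - x)).
rewrite sqrrB !sqr_sqrtr ?subr_ge0 //; lra.
Qed.

Lemma powsum_small e x : 0 <= e <= 2^-1 -> 0 <= x <= 25^-1 ->
  powsum e x <= 2 `^ (e / 2).
Proof.
move=> e01 /andP[x0 x1]; rewrite -(sqr_sqrtr x0).
have r0 := sqrtr_ge0 x.
have r1 : Num.sqrt x <= 5^-1.
  by rewrite -(@ler_pXn2r _ 2) ?nnegrE ?invr_ge0 ?ler0n // sqr_sqrtr //; lra.
(* 1.18 is the value of [r + 1 - r ^+ 2 / 2] at [r = 1 / 5], and its fourth power is below 2. *)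
apply: (@le_trans _ _ ((118 / 100) `^ (2 * e))).
  apply: powsum_le => //; first lra.
    by rewrite r0; lra.
  set r := Num.sqrt x in r0 r1 *.
  have : Num.sqrt (1 - r ^+ 2) <= 1 - r ^+ 2 / 2.
    rewrite -(@ler_pXn2r _ 2) ?nnegrE ?sqrtr_ge0 ?sqr_sqrtr //; nra.
  nra.
have -> : 2 * e = 4%:R * (e / 2) by field.
rewrite powRrM powR_mulrn; last lra.
case/andP: e01 => e0 _; apply: ge0_ler_powR; rewrite ?nnegrE ?divr_ge0 //; lra.
Qed.

(** If [y] is small, each factor costs only [2]^ (e / 2)[. Otherwise the subtracted term is at
    least]2 [^ e / 25 * x]^ (1 - e)[, which lowers the coefficient of]x [^ (1 - e)] to 24/25. *)
Lemma powsum_mul_le e t x y : 0 < e <= 150^-1 -> 0 < t ->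
  t `^ (- e) <= 149 / 144 -> 0 <= x -> x <= y -> y <= 1 ->
  powsum e x * powsum e y - (x * y) `^ (1 - e) <= (1 + t) * 2 `^ e.
Proof.
move=> /andP[e0 e1] t0 te x0 xy y1.
have e01 : 0 <= e <= 2^-1 by lra.
have c0 : 0 < (2 : R) `^ e by rewrite powR_gt0.
have [ylarge|ysmall] := leP 25^-1 y; last first.
  have : powsum e x * powsum e y <= 2 `^ (e / 2) * 2 `^ (e / 2).
    by apply: ler_pM; rewrite ?powsum_ge0 ?powsum_small ?x0 //; lra.
  rewrite -powRD -?splitr ?pnatr_eq0 ?implybT //.
  have := powR_ge0 (x * y) (1 - e); nra.
have Sy : powsum e y <= 2 `^ e by apply: powsum_le2; lra.
have ys : 2 `^ e / 25 <= y `^ (1 - e).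
  apply: (@le_trans _ _ (25^-1 `^ (1 - e))); last first.
    by apply: ge0_ler_powR; rewrite ?nnegrE //; lra.
  rewrite powRB ?powRr1 ?invr_ge0 ?implybT ?invr_eq0 ?pnatr_eq0 //; try lra.
  have -> : 25^-1 `^ e = (25 `^ e)^-1 :> R.
    by rewrite -[25^-1]powR_inv1 // -powRrM mulN1r powRN.
  rewrite invrK mulrC.
  by rewrite ler_wpM2l ?invr_ge0 ?ler0n // ge0_ler_powR ?nnegrE ?ler_nat //; lra.
rewrite powRM //; last lra.
suff key : 24 / 25 * x `^ (1 - e) + (1 - x) `^ (1 - e) <= 1 + t.
  have : powsum e x * powsum e y <= powsum e x * 2 `^ e.
    by rewrite ler_wpM2l ?powsum_ge0.
  have : x `^ (1 - e) * (2 `^ e / 25) <= x `^ (1 - e) * y `^ (1 - e).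
    by rewrite ler_wpM2l ?powR_ge0.
  move: key; rewrite -(ler_pM2r c0) /powsum; nra.
have h1 : (1 - x) `^ (1 - e) <= 1 + (1 - e) * (1 - x - 1).
  by apply: powR_le_tangent; lra.
have powS (z : R) : 0 < z -> z `^ (1 - e) = z * z `^ (- e).
  by move=> z0; rewrite powRD ?(gt_eqF z0) ?implybT // powRr1 // ltW.
have [xt|xt] := leP t x.
  have x_gt0 : 0 < x by lra.
  have xe : x `^ (- e) <= 149 / 144.
    apply: le_trans te; rewrite !powRN lef_pV2 ?posrE ?powR_gt0 //.
    by apply: ge0_ler_powR; rewrite ?nnegrE //; lra.
  rewrite powS //; nra.
have : x `^ (1 - e) <= t * (149 / 144).
  apply: (@le_trans _ _ (t `^ (1 - e))).
    by apply: ge0_ler_powR; rewrite ?nnegrE //; lra.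
  by rewrite powS // ler_wpM2l // ltW.
nra.
Qed.

(** By homogeneity both totals may be scaled to 1; the left side is then a product of two power sums
    minus the term of the missing pair [a1], [b0]. *)
Lemma powR_three_le e t a0 a1 b0 b1 : 0 < e <= 150^-1 -> 0 < t ->
  t `^ (- e) <= 149 / 144 -> 0 <= a0 -> 0 <= a1 -> 0 <= b0 -> 0 <= b1 ->
  (a0 * b0) `^ (1 - e) + (a0 * b1) `^ (1 - e) + (a1 * b1) `^ (1 - e) <=
  (1 + t) * 2 `^ e * ((a0 + a1) * (b0 + b1)) `^ (1 - e).
Proof.
move=> e01 t0 te a00 a10 b00 b10.
have sN0 : 1 - e != 0 by lra.
have rhs0 (z : R) : 0 <= (1 + t) * 2 `^ e * z `^ (1 - e).
  by rewrite !mulr_ge0 ?powR_ge0 //; lra.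
have [u0|uN0] := eqVneq (a0 + a1) 0.
  have [-> ->] : a0 = 0 /\ a1 = 0 by lra.
  by rewrite !mul0r powR0 // !addr0.
have [v0|vN0] := eqVneq (b0 + b1) 0.
  have [-> ->] : b0 = 0 /\ b1 = 0 by lra.
  by rewrite !mulr0 powR0 // !addr0.
set u := a0 + a1 in uN0 *; set v := b0 + b1 in vN0 *.
have u0 : 0 < u by rewrite lt_neqAle eq_sym uN0 addr_ge0.
have v0 : 0 < v by rewrite lt_neqAle eq_sym vN0 addr_ge0.
pose x := a1 / u; pose y := b0 / v.
have Ea1 : a1 = x * u by rewrite /x divfK.
have Ea0 : a0 = (1 - x) * u by rewrite mulrBl -Ea1 /u; lra.
have Eb0 : b0 = y * v by rewrite /y divfK.
have Eb1 : b1 = (1 - y) * v by rewrite mulrBl -Eb0 /v; lra.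
have x0 : 0 <= x by rewrite divr_ge0 // ltW.
have y0 : 0 <= y by rewrite divr_ge0 // ltW.
have x1 : 0 <= 1 - x by rewrite -(pmulr_lge0 _ u0) -Ea0.
have y1 : 0 <= 1 - y by rewrite -(pmulr_lge0 _ v0) -Eb1.
have main : powsum e x * powsum e y - (x * y) `^ (1 - e) <= (1 + t) * 2 `^ e.
  have [xy|/ltW yx] := leP x y; first by apply: powsum_mul_le => //; lra.
  by rewrite mulrC (mulrC x); apply: powsum_mul_le => //; lra.
have w0 : 0 <= (u * v) `^ (1 - e) by rewrite powR_ge0.
have := ler_wpM2r w0 main; apply: le_trans.
have E (c d : R) : 0 <= c -> 0 <= d ->
    (c * u * (d * v)) `^ (1 - e) = c `^ (1 - e) * d `^ (1 - e) * (u * v) `^ (1 - e).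
  move=> c0 d0; rewrite mulrACA !(powRM (1 - e)) ?mulr_ge0 //; exact: ltW.
rewrite Ea0 Eb0 Ea1 Eb1 !E // (powRM _ x0 y0) /powsum le_eqVlt.
by apply/orP; left; apply/eqP; ring.
Qed.

Lemma one_add_exp_le t k : 0 <= t -> (1 + t) ^+ k * (1 - k%:R * t) <= 1.
Proof.
move=> t0; elim: k => [|k IH]; first by rewrite expr0 mul0r subr0 mulr1.
apply: le_trans IH; rewrite exprSr -mulrA ler_wpM2l ?exprn_ge0 //; first lra.
rewrite -natr1; have := ler0n R k; nra.
Qed.

End OneDim.

(** * Tensorisation over the ground set *)

(** The set [V] carries the induction within a fixed type: each point of [V] costs one factor from
    [powR_three_le]. *)
Lemma containments_powR (R : realType) (T : finType) (e t : R) (V : {set T})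
    (A B : {set {set T}}) : 0 < e <= 150^-1 -> 0 < t -> t `^ (- e) <= 149 / 144 ->
  A \subset powerset V -> B \subset powerset V ->
  (containments A B)%:R <=
    ((1 + t) * 2 `^ e) ^+ #|V| * (#|A|%:R * #|B|%:R) `^ (1 - e) :> R.
Proof.
move=> e01 t0 te; move Ek: #|V| => k; elim: k V A B Ek => [|k IH] V A B.
  move/eqP; rewrite cards_eq0 => /eqP -> AV BV.
  rewrite expr0 mul1r -natrM.
  have card1 (C : {set {set T}}) : C \subset powerset set0 -> (#|C| <= 1)%N.
    by move/subset_leq_card; rewrite card_powerset cards0.
  apply: (@le_trans _ _ (#|A| * #|B|)%N%:R); first by rewrite ler_nat containments_le.
  (* The product of the sizes is 0 or 1, and both are fixed by the power since [1 - e] is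
     nonzero. *)
  have := leq_mul (card1 _ AV) (card1 _ BV); case: (_ * _)%N => [|[|//]] _.
    by rewrite powR0 //; lra.
  by rewrite powR1.
move=> cV; have /card_gt0P[x xV] : (0 < #|V|)%N by rewrite cV.
have cV' : #|V :\ x| = k by move: cV; rewrite (cardsD1 x) xV => -[].
move=> AV BV.
have av (C : {set {set T}}) : C \subset powerset V ->
    avoid x C \subset powerset (V :\ x).
  move/subsetP=> CV; apply/subsetP => X; rewrite !inE => /andP[XC xX].
  by rewrite subsetD1 xX andbT; have := CV _ XC; rewrite inE.
have de (C : {set {set T}}) : C \subset powerset V ->
    del x C \subset powerset (V :\ x).
  move/subsetP=> CV; apply/subsetP => ? /imsetP[X].
  by rewrite !inE => /andP[XC xX] ->; rewrite setSD //; have := CV _ XC; rewrite inE.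
rewrite (containments_split x) (card_split x A) (card_split x B) !natrD.
have h1 := IH _ _ _ cV' (av _ AV) (av _ BV).
have h2 := IH _ _ _ cV' (av _ AV) (de _ BV).
have h3 := IH _ _ _ cV' (de _ AV) (de _ BV).
apply: le_trans (lerD (lerD h1 h2) h3) _.
rewrite -!mulrDr exprSr -mulrA ler_wpM2l ?powR_three_le ?ler0n //.
by rewrite exprn_ge0 // mulr_ge0 ?powR_ge0 //; lra.
Qed.

(** * Constants and conclusion *)

Lemma powR2_le (R : realType) : (2 : R) `^ (7 / 150) <= 149 / 144.
Proof.
have pow21 : (2 : R) <= (149 / 144) ^+ 21.
  have z2 : 107 / 100 <= (149 / 144 : R) ^+ 2 by lra.
  have z4 : 114 / 100 <= (149 / 144 : R) ^+ 4.
    by rewrite (exprM _ 2 2); apply: le_trans (lerXn2r 2 _ _ z2); rewrite ?nnegrE; lra.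
  have z5 : 117 / 100 <= (149 / 144 : R) ^+ 5 by rewrite exprS; lra.
  have z10 : 136 / 100 <= (149 / 144 : R) ^+ 10.
    by rewrite (exprM _ 5 2); apply: le_trans (lerXn2r 2 _ _ z5); rewrite ?nnegrE; lra.
  have z20 : 184 / 100 <= (149 / 144 : R) ^+ 20.
    by rewrite (exprM _ 10 2); apply: le_trans (lerXn2r 2 _ _ z10); rewrite ?nnegrE; lra.
  rewrite exprS; lra.
apply: (@le_trans _ _ (((149 / 144) ^+ 21) `^ (7 / 150))).
  by apply: ge0_ler_powR; rewrite ?nnegrE ?exprn_ge0 //; lra.
rewrite -powR_mulrn -?powRrM; last lra.
by apply: ler1_powR; lra.
Qed.

Lemma few_noncontainments (R : realType) (n : nat) (A B : {set {set 'I_n}}) (eta W : R) :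
  (2 <= n)%N -> 0 <= eta -> 64 * eta <= 1 -> 16 * n%:R * eta <= 1 ->
  (containments A B)%:R = (1 - eta) * (#|A|%:R * #|B|%:R) ->
  1 <= W -> W ^+ 300 * 2 ^+ n <= #|A|%:R * #|B|%:R ->
  W <= 1 + eta.
Proof.
move=> hn eta0 eta64 eta16 Ec W1 WQ.
have W0 : 0 < W by lra.
have Q0 : 0 < #|A|%:R * #|B|%:R :> R.
  by apply: lt_le_trans WQ; rewrite mulr_gt0 ?exprn_gt0.
have [a0 b0] : 0 < #|A|%:R :> R /\ 0 < #|B|%:R :> R.
  by move: Q0; rewrite -natrM !ltr0n muln_gt0 => /andP.
have EN : (#|A| * #|B| - containments A B)%:R = eta * (#|A|%:R * #|B|%:R) :> R.
  by rewrite natrB ?containments_le // Ec natrM; ring.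
have [||| a [b [ab hA hB aA bB]]] := @almost_product _ A B.
- by rewrite card_ord ltnW.
- rewrite card_ord -(@ler_nat R) natrM EN !natrM; nra.
- rewrite card_ord -(@ler_nat R) natrM natrX; apply: le_trans WQ.
  by rewrite ler_peMl ?exprn_ge0 // exprn_ege1.
have la : (1 - 12 * eta) * #|A|%:R <= a%:R.
  move: hA; rewrite -(@ler_nat R) !natrM natrB // EN => h.
  rewrite -(ler_pM2r b0); nra.
have lb : (1 - 12 * eta) * #|B|%:R <= b%:R.
  move: hB; rewrite -(@ler_nat R) !natrM natrB // EN => h.
  rewrite -(ler_pM2r a0); nra.
move: ab; rewrite card_ord -(@ler_nat R) natrM natrX => ab.
have z0 : 0 <= 1 - 12 * eta by lra.
have P1 : (1 - 12 * eta) ^+ 2 * W ^+ 300 <= 1.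
  rewrite -(ler_pM2r (exprn_gt0 n (ltr0Sn R 1))) mul1r -mulrA.
  apply: le_trans (ler_wpM2l (exprn_ge0 2 z0) WQ) _.
  apply: le_trans ab; apply: le_trans (ler_pM _ _ la lb); rewrite ?mulr_ge0 ?ler0n //.
  by rewrite le_eqVlt; apply/orP; left; apply/eqP; ring.
have P2 : (1 - 12 * eta) * W ^+ 150 <= 1.
  rewrite -(@ler_pXn2r _ 2) ?nnegrE ?mulr_ge0 ?exprn_ge0 ?(ltW W0) //.
  by rewrite exprMn -exprM expr1n.
have bern : 1 + 150 * eta <= (1 + eta) ^+ 150.
  have : forall k, 1 + k%:R * eta <= (1 + eta) ^+ k.
    elim=> [|k IH]; first by rewrite expr0 mul0r addr0.
    have : (1 + eta) * (1 + k%:R * eta) <= (1 + eta) ^+ k.+1.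
      by rewrite exprS ler_wpM2l //; lra.
    apply: le_trans; rewrite -natr1; have := ler0n R k; nra.
  by move/(_ 150%N).
rewrite -(@ler_pXn2r _ 150) ?nnegrE ?addr_ge0 ?(ltW W0) //.
(* As [eta <= 1 / 64], the product [(1 - 12 * eta) * (1 + 150 * eta)] is at least 1; compare with
   [P2]. *)
apply: le_trans bern; nra.
Qed.

Theorem theorem1p3 (R : realType) (n : nat) (d : R) (A B : {set {set 'I_n}})
    (hn : (2 <= n)%N)
    (hAB : #|A|%:R * #|B|%:R = n%:R `^ d * 2 ^+ n :> R) :
  (containments A B)%:R <= 2 `^ (- d / 300) * (#|A|%:R * #|B|%:R) :> R.
Proof.
have n0 : (0 : R) < n%:R by rewrite ltr0n ltnW.
have n2 : (2 : R) <= n%:R by rewrite ler_nat.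
have Q0 : 0 < #|A|%:R * #|B|%:R :> R by rewrite hAB mulr_gt0 ?powR_gt0 ?exprn_gt0.
have cQ : (containments A B)%:R <= #|A|%:R * #|B|%:R :> R.
  by rewrite -natrM ler_nat containments_le.
have [d0|d0] := leP d 0.
  apply: le_trans cQ _; rewrite ler_peMl ?(ltW Q0) //.
  by rewrite -[leLHS](powRr0 2) ler_powR ?ler1n //; lra.
pose L : R := ln n%:R; pose l2 : R := ln 2.
have l20 : 0 < l2 by rewrite ln_gt0 // ltr1n.
have lL : l2 <= L by rewrite ler_ln ?posrE.
have L0 : 0 < L by lra.
(* This [e] is twice the exponent to be proved, so that the bound carries the square of the target
   factor [W]. *)
pose e := l2 / (150 * L); pose t : R := n%:R ^- 7.
have eL : e * L = l2 / 150 by rewrite /e; field; rewrite gt_eqF.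
have e01 : 0 < e <= 150^-1.
  rewrite divr_gt0 ?mulr_gt0 //= -(ler_pM2r L0) eL; lra.
have t0 : 0 < t by rewrite invr_gt0 exprn_gt0.
have powE (x y : R) : 0 < x -> x `^ y = expR (y * ln x).
  by move=> x0; rewrite /powR gt_eqF.
have te : t `^ (- e) <= 149 / 144.
  apply: le_trans (powR2_le R).
  rewrite !powE // /t lnV ?posrE ?exprn_gt0 // lnXn // -/L -/l2.
  by rewrite mulrNN mulrnAr eL -mulr_natr ler_expR; lra.
set W := 2 `^ (- d / 300).
have W0 : 0 < W by rewrite powR_gt0.
have W2 : (n%:R `^ d) `^ (- e) = W ^+ 2.
  rewrite -(powR_mulrn 2 (ltW W0)) /W -!powRrM !powE // -/L -/l2.
  by congr expR; rewrite mulrN mulNr -mulrA eL; field.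
have bound := @containments_powR R 'I_n e t setT A B e01 t0 te.
rewrite powersetT !subsetT cardsT card_ord in bound; move: (bound isT isT) => {}bound.
set Q := _ * _ in hAB Q0 cQ bound *; set c := _%:R in cQ bound *.
have {}bound : c <= (1 + t) ^+ n * W ^+ 2 * Q.
  apply: le_trans bound _; rewrite le_eqVlt; apply/orP; left; apply/eqP.
  have -> : Q `^ (1 - e) = Q `^ (- e) * Q.
    by rewrite addrC powRD ?(gt_eqF Q0) ?implybT // powRr1 // ltW.
  rewrite {1}hAB powRM ?powR_ge0 ?exprn_ge0 // W2 exprMn.
  have -> : (2 `^ e) ^+ n = ((2 ^+ n) `^ (- e))^-1.
    by rewrite -powRN opprK -(powR_mulrn n (powR_ge0 2 e)) -(powR_mulrn n (ler0n R 2)) powRAC.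
  by field; rewrite gt_eqF // powR_gt0 ?exprn_gt0.
rewrite leNgt; apply/negP => cW.
pose p := c / Q; have cE : c = p * Q by rewrite /p divfK ?gt_eqF.
have pW : W < p by rewrite -(ltr_pM2r Q0) -cE.
have p1 : p <= 1 by rewrite -(ler_pM2r Q0) -cE mul1r.
have {}bound : p <= (1 + t) ^+ n * W ^+ 2 by rewrite -(ler_pM2r Q0) -cE.
have K0 : 0 < (1 + t) ^+ n by rewrite exprn_gt0 //; lra.
(* From [W < p], the bound gives [p < (1 + t) ^+ n * p ^+ 2]; cancel [p]. *)
have Kp : 1 < (1 + t) ^+ n * p.
  have : W ^+ 2 < p ^+ 2 by rewrite ltr_pXn2r ?nnegrE //; lra.
  move=> h; rewrite -(ltr_pM2l K0) in h; rewrite ltNge; apply/negP => Kp1.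
  have := ler_wpM2r (ltW (lt_trans W0 pW)) Kp1.
  rewrite /= mul1r -mulrA -expr2; lra.
have nt : n%:R * t = n%:R ^- 6 by rewrite /t; field; rewrite gt_eqF.
have etat : 1 - p < n%:R * t.
  rewrite ltNge; apply/negP => h; have := one_add_exp_le n (ltW t0).
  rewrite leNgt => /negP; apply; apply: lt_le_trans Kp _.
  by rewrite ler_pM2l //; lra.
have n5 : 32 <= n%:R ^+ 5 :> R.
  have := lerXn2r 5 _ _ n2; rewrite ?nnegrE ?ler0n // => /(_ isT isT); lra.
have ntn : n%:R * t * n%:R * n%:R ^+ 5 = 1.
  by rewrite nt; field; rewrite gt_eqF.
have nt0 : 0 < n%:R * t * n%:R by rewrite !mulr_gt0.
(* With [1 - p < n%:R * t] and [2 <= n%:R], this yields both smallness hypotheses of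
   [few_noncontainments]. *)
have small : 32 * (n%:R * t * n%:R) <= 1 by nra.
(* This contradicts [W < p], because [p * (2 - p) <= 1]. *)
suff : W^-1 <= 1 + (1 - p).
  apply/negP; rewrite -ltNge -(ltr_pM2r W0) mulVf ?gt_eqF //; nra.
apply: (few_noncontainments (A := A) (B := B) hn).
- lra.
- nra.
- nra.
- by rewrite -/c -/Q cE; ring.
- rewrite invf_ge1 // -[leRHS](powRr0 2) ler_powR ?ler1n //; lra.
- rewrite -/Q hAB ler_pM2r ?exprn_gt0 //.
  rewrite -powRN -(powR_mulrn 300 (powR_ge0 _ _)) -powRrM !powE // -/L -/l2 ler_expR.
  have -> : - (- d / 300) * 300%:R * l2 = d * l2 by field.
  by rewrite ler_pM2l.
Qed.
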